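(* Let $\Omega$ be an atomless Borel probability space with measure $\nu$ and let $W:\Omega^2\to[0,1]$ be a graphon. Then every extreme point $\mathfrak c$ of the set $\mathrm{FCOV}(W)$ of all fractional vertex covers of $W$ is half-integral, i.e. $\mathfrak c(x)\in\{0,\tfrac12,1\}$ for almost every $x\in\Omega$.
   Context: A graphon is a symmetric measurable function $W:\Omega^2\to[0,1]$. Write $\operatorname{supp} W=\{(x,y): W(x,y)>0\}$. A fractional vertex cover of $W$ is a function $\mathfrak c\in L^\infty(\Omega)$ such that $0\le\mathfrak c\le 1$ almost everywhere and the set $\operatorname{supp}W\setminus\{(x,y):\mathfrak c(x)+\mathfrak c(y)\ge 1\}$ has $\nu^{\otimes 2}$-measure $0$. $\mathrm{FCOV}(W)\subseteq L^\infty(\Omega)$ is the (convex) set of all fractional vertex covers of $W$. A point $x$ of a convex set $X$ is extreme if the only pair $x',x''\in X$ with $x=\frac12(x'+x'')$ is $x'=x''=x$. *)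

(* Defs.v *)
From HB Require Import structures.
From mathcomp Require Import all_boot all_order all_algebra.
From mathcomp Require Import all_classical all_reals all_analysis.

Set Implicit Arguments.
Unset Strict Implicit.
Unset Printing Implicit Defensive.

Import Order.TTheory GRing.Theory Num.Theory.
Import numFieldNormedType.Exports.

Local Open Scope classical_set_scope.
Local Open Scope ring_scope.

(* Measurably isomorphic to the Borel sigma-algebra of a Polish space; a
   Hausdorff pseudometric space is a metric space. *)
Definition standard_borel (R : realType) (d : measure_display)
    (T : measurableType d) : Prop :=
  exists (X : completePseudoMetricType R) (f : T -> X),
    [/\ hausdorff_space X,
        exists2 D : set X, countable D & dense D,
        bijective f &
        forall A : set T, measurable A <-> <<s @open X >> (f @` A)].

Definition atomless (R : realType) (d : measure_display)
    (T : measurableType d) (nu : {measure set T -> \bar R}) : Prop :=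
  forall A : set T, measurable A -> (0 < nu A)%E ->
    exists B : set T,
      [/\ measurable B, B `<=` A, (0 < nu B)%E & (nu B < nu A)%E].

Definition graphon (R : realType) (d : measure_display)
    (T : measurableType d) (W : T * T -> R) : Prop :=
  [/\ measurable_fun setT W,
      forall x y : T, W (x, y) = W (y, x) &
      forall z : T * T, 0 <= W z <= 1].

Definition supp (R : realType) (d : measure_display)
    (T : measurableType d) (W : T * T -> R) : set (T * T) :=
  [set z | 0 < W z].

(* Elements are classes of a.e. equal functions; applying one to a point goes
   through a chosen measurable representative. *)
Definition Linfty (R : realType) (d : measure_display)
    (T : measurableType d) (nu : probability T R) : Type :=
  LspaceType nu (leey 1%E).

Definition Linfty_fun (R : realType) (d : measure_display)
    (T : measurableType d) (nu : probability T R) (c : Linfty nu) : T -> R :=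
  aqEqMfun_to_fun (LebesgueSpace.sort c).
Coercion Linfty_fun : Linfty >-> Funclass.

Definition FCOV (R : realType) (d : measure_display)
    (T : measurableType d) (nu : probability T R) (W : T * T -> R) :
    set (Linfty nu) :=
  [set c | {ae nu, forall x, 0 <= c x <= 1} /\
    (nu \x nu)%E (supp W `\` [set z : T * T | 1 <= c z.1 + c z.2]) = 0%E].
Arguments FCOV {R d T} nu W.

(* The equation c = (c' + c'') / 2 in Linfty is a.e. equality of
   representatives, while c' = c and c'' = c are equalities in Linfty. *)
Definition extreme_point (R : realType) (d : measure_display)
    (T : measurableType d) (nu : probability T R)
    (X : set (Linfty nu)) (c : Linfty nu) : Prop :=
  X c /\
  forall c' c'' : Linfty nu, X c' -> X c'' ->
    {ae nu, forall x, c x = 2^-1 * (c' x + c'' x)} -> c' = c /\ c'' = c.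

(* Main.v *)
(* Let p(t) = t (1 - t) (1 - 2 t). It vanishes exactly at 0, 1/2 and 1, it
   satisfies p(1 - t) = - p(t), and its derivative lies in [-1/2, 1] on [0, 1],
   so both t + p(t) and t - p(t) are nondecreasing on [0, 1], fix 0 and 1 and
   commute with t |-> 1 - t. Hence they preserve 1 <= t + u, that is,
   composing with them maps fractional vertex covers to fractional vertex
   covers. A cover c is the midpoint of c + p(c) and c - p(c), so extremality
   forces p(c) = 0 almost everywhere. *)
Require Import Defs.
From HB Require Import structures.
From mathcomp Require Import all_boot all_order all_algebra.
From mathcomp Require Import all_classical all_reals all_analysis.
From mathcomp Require Import measurable_realfun ess_sup_inf ring lra.

Import Order.TTheory GRing.Theory Num.Theory.
Import numFieldNormedType.Exports.

Local Open Scope classical_set_scope.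
Local Open Scope ring_scope.

(** This is [t + s * p(t)] for the polynomial p above; the parameter [s] lets one argument serve
    both signs. *)
Definition cubic_shift {R : realType} (s t : R) : R :=
  t + s * (t * (1 - t) * (1 - 2 * t)).

Lemma cubic_shift_mid {R : realType} (t : R) :
  t = 2^-1 * (cubic_shift 1 t + cubic_shift (-1) t).
Proof. by rewrite /cubic_shift; field. Qed.

Lemma cubic_shift_eq_id {R : realType} (t : R) :
  cubic_shift 1 t = t -> t = 0 \/ t = 2^-1 \/ t = 1.
Proof.
rewrite /cubic_shift => /(congr1 (fun x => x - t)).
rewrite subrr addrAC subrr add0r.
move=> /eqP; rewrite mul1r !mulf_eq0 !subr_eq0 => /orP[/orP[|]|] /eqP.
- by left.
- by right; right.
- by move=> t2; right; left; lra.
Qed.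

Lemma cubic_shift_sym {R : realType} (s t : R) : cubic_shift s (1 - t) =
  1 - cubic_shift s t.
Proof. by rewrite /cubic_shift; ring. Qed.

Lemma cubic_shift_homo {R : realType} (s t u : R) : -1 <= s <= 1 ->
  0 <= t <= 1 -> 0 <= u <= 1 -> t <= u -> cubic_shift s t <= cubic_shift s u.
Proof.
move=> s1 t01 u01 tu.
(* The factor multiplying [s] is the divided difference (p(u) - p(t)) / (u - t) in polynomial form;
   it stays in [-1, 1] for [t], [u] in [0, 1]. *)
rewrite -subr_ge0 (_ : _ - _ =
  (u - t) * (1 + s * (1 - 3 * (t + u) + 2 * (t * t + t * u + u * u)))).
  2: by rewrite /cubic_shift; ring.
apply: mulr_ge0; first lra.
set q := (X in s * X).
have q1 : q <= 1 by rewrite /q; nra.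
have qN1 : -1 <= q.
  (* In the variables [t - u] and [t + u - 1] the quadratic [q + 1] has no cross term and is a sum
     of squares plus 1/2. *)
  rewrite -subr_ge0 (_ : _ - _ =
    (t - u) ^+ 2 / 2 + (3 * (t + u - 1) ^+ 2 + 1) / 2).
    2: by rewrite /q; field.
  have := sqr_ge0 (t - u); have := sqr_ge0 (t + u - 1); lra.
nra.
Qed.

Lemma cubic_shift_range {R : realType} (s t : R) : -1 <= s <= 1 ->
  0 <= t <= 1 -> 0 <= cubic_shift s t <= 1.
Proof.
move=> s1 t01.
have h0 : cubic_shift s 0 <= cubic_shift s t by apply: cubic_shift_homo; lra.
have h1 : cubic_shift s t <= cubic_shift s 1 by apply: cubic_shift_homo; lra.
by move: h0 h1; rewrite /cubic_shift subrr !(mul0r, mulr0, addr0) => -> ->.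
Qed.

Lemma cubic_shift_cover {R : realType} (s t u : R) : -1 <= s <= 1 ->
  0 <= t <= 1 -> 0 <= u <= 1 -> 1 <= t + u ->
  1 <= cubic_shift s t + cubic_shift s u.
Proof.
move=> s1 t01 u01 tu.
(* The covering condition is read as [1 - u <= t], to which monotonicity and the symmetry apply. *)
have := @cubic_shift_homo _ s (1 - u) t s1; rewrite cubic_shift_sym => h.
have : 1 - cubic_shift s u <= cubic_shift s t by apply: h; lra.
lra.
Qed.

Lemma measurable_cubic_shift {R : realType} (s : R) :
  measurable_fun setT (cubic_shift s).
Proof.
apply: measurable_funD => //; apply: measurable_funM => //.
apply: measurable_funM.
  by apply: measurable_funM => //; exact: measurable_funB.
by apply: measurable_funB => //; exact: measurable_funM.
Qed.

Section fractional_covers.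
Context {R : realType} {d : measure_display} {T : measurableType d}.
Context {nu : probability T R}.

Lemma measurable_Linfty (c : Linfty nu) : measurable_fun setT c.
Proof.
(* R and measurableTypeR R carry the same sigma-algebra under two displays. *)
have mc := @measurable_funP _ _ _ _ setT (repr (LebesgueSpace.sort c)).
by move=> mT A mA; exact: mc.
Qed.

(** Turns a pointwise formula, such as a shifted cover, into an element of [Linfty]. Equality holds
    only almost everywhere because the class is evaluated through a chosen representative. *)
Lemma Linfty_of_bounded (f : T -> R) : measurable_fun setT f ->
  {ae nu, forall x, 0 <= f x <= 1} ->
  exists c : Linfty nu, {ae nu, forall x, c x = f x}.
Proof.
move=> mf f01.
have mf' : measurable_fun setT (f : T -> measurableTypeR R).
  by move=> mT A mA; exact: mf.
pose F : {mfun T >-> measurableTypeR R} :=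
  HB.pack (f : T -> measurableTypeR R)
    (isMeasurableFun.Build _ _ T (measurableTypeR R) _ mf').
pose q : {mfun_ nu, T >-> measurableTypeR R} :=
  (\pi_({mfun_ nu, T >-> measurableTypeR R}) F)%qT.
have qf : {ae nu, forall x, q x = f x}.
  have : ae_eq_op nu (repr q) F by rewrite -eqmodE /q reprK.
  by move=> /asboolP; apply: filterS => x /(_ I).
(* The norm at exponent [+oo] is an essential supremum, here at most 1. *)
have qfin : finite_norm nu +oo q.
  rewrite /finite_norm unlock; case: ifP => // _.
  apply: (@le_lt_trans _ _ 1%E); last exact: ltry.
  apply/ess_supP; apply: filterS2 qf f01 => x /= -> /andP[f0 f1].
  by rewrite lee_fin ger0_norm.
exists (HB.pack_for (LspaceType nu (leey 1%E)) q
  (isFinLebesgue.Build _ _ _ nu _ (leey 1%E) q qfin)).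
exact: qf.
Qed.

(** Off a null set [N] the hypotheses on [g] apply pointwise. So a pair of the support left
    uncovered by [c'] is already uncovered by [c] or has a coordinate in [N], and the pairs of the
    latter kind are null for the product measure. *)
Lemma FCOV_comp (W : T * T -> R) (g : R -> R) (c c' : Linfty nu) :
  measurable_fun setT W ->
  (forall t, 0 <= t <= 1 -> 0 <= g t <= 1) ->
  (forall t u, 0 <= t <= 1 -> 0 <= u <= 1 -> 1 <= t + u -> 1 <= g t + g u) ->
  {ae nu, forall x, c' x = g (c x)} ->
  FCOV nu W c -> FCOV nu W c'.
Proof.
move=> mW g01 gcov c'g [c01 ccov]; split.
  by apply: filterS2 c'g c01 => x -> /g01.
(* Measurability of the uncovered set lets the null-set inclusion and union arguments below
   apply. *)
have mbad (e : Linfty nu) :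
    measurable (supp W `\` [set z : T * T | 1 <= e z.1 + e z.2]).
  have me : measurable_fun setT (fun z : T * T => e z.1 + e z.2).
    by apply: measurable_funD; apply: measurableT_comp => //;
      exact: measurable_Linfty.
  apply: measurableD.
    rewrite (_ : supp W = W @^-1` `]0, +oo[).
      by rewrite -[X in measurable X]setTI; exact: mW.
    by apply/seteqP; split => z /=; rewrite in_itv /= andbT.
  rewrite (_ : [set _ | _] = (fun z => e z.1 + e z.2) @^-1` `[1, +oo[).
    by rewrite -[X in measurable X]setTI; exact: me.
  by apply/seteqP; split => z /=; rewrite in_itv /= andbT.
have [N [mN N0 badN]] :
    {ae nu, forall x, 0 <= c x <= 1 /\ c' x = g (c x)}.
  by apply: filterS2 c'g c01 => x.
have NE x : ~ N x -> 0 <= c x <= 1 /\ c' x = g (c x).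
  by move=> Nx; apply: contrapT => h; apply: Nx; exact: badN.
have null1 : (nu \x nu)%E (N `*` setT) = 0%E.
  by rewrite product_measure1E// [X in (X * _)%E]N0 mul0e.
have null2 : (nu \x nu)%E (setT `*` N) = 0%E.
  by rewrite product_measure1E// [X in (_ * X)%E]N0 mule0.
apply: (@subset_measure0 _ _ _ (nu \x nu)%E _
  ((supp W `\` [set z : T * T | 1 <= c z.1 + c z.2]) `|`
   (N `*` setT `|` setT `*` N))).
- exact: mbad.
- by apply: measurableU; [exact: mbad|apply: measurableU; exact: measurableX].
- move=> z [Wz /= c'z].
  have [Nz1|/NE[c1 c'1]] := pselect (N z.1); first by right; left.
  have [Nz2|/NE[c2 c'2]] := pselect (N z.2); first by right; right.
  left; split => //= cz; apply: c'z; rewrite c'1 c'2; exact: gcov.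
- have nullU := null_set_setU (measurableX mN measurableT)
    (measurableX measurableT mN) null1 null2.
  apply: (null_set_setU (mbad c) _ ccov nullU).
  by apply: measurableU; exact: measurableX.
Qed.

End fractional_covers.

Theorem theorem13 (R : realType) (d : measure_display) (T : measurableType d)
  (nu : probability T R) (W : T * T -> R)
  (T_borel : standard_borel R T) (nu_atomless : atomless nu)
  (W_graphon : graphon W) :
  forall c : Linfty nu, extreme_point (FCOV nu W) c ->
    {ae nu, forall x, c x = 0 \/ c x = 2^-1 \/ c x = 1}.
Proof.
move=> c [cW cext].
have [mW _ _] := W_graphon.
have shifted (s : R) : -1 <= s <= 1 -> exists c' : Linfty nu,
    FCOV nu W c' /\ {ae nu, forall x, c' x = cubic_shift s (c x)}.
  move=> s1.
  have [||c' c'E] := @Linfty_of_bounded R d T nu (cubic_shift s \o c).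
  - apply: measurableT_comp; first exact: measurable_cubic_shift.
    exact: measurable_Linfty.
  - by case: cW => c01 _; apply: filterS c01 => x; exact: cubic_shift_range.
  - exists c'; split => //; apply: (FCOV_comp _ _ _ _ mW _ _ c'E cW) => t.
    + exact: cubic_shift_range.
    + by move=> u; exact: cubic_shift_cover.
have [|c1 [c1W c1E]] := shifted 1; first lra.
have [|c2 [c2W c2E]] := shifted (-1); first lra.
have [|c1c _] := cext _ _ c1W c2W.
  by apply: filterS2 c1E c2E => x -> ->; exact: cubic_shift_mid.
(* As [c1] and [c] are the same class, [c1E] now says that almost every value of [c] is a fixed
   point of [cubic_shift 1], that is, a root of p. *)
rewrite c1c in c1E.
by apply: filterS c1E => x /esym; exact: cubic_shift_eq_id.
Qed.
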